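(* Let $n_{\min}, n_{\max}$ be constants with $n_{\min}\le n(x)\le n_{\max}$ for a.e. $x\in D$, and let $k$ be a real transmission eigenvalue (with conductive boundary condition) for $D$, $n$, $\eta$. Then $$k^2\ \ge\ \frac{\lambda_1}{n_{\max}}\quad\text{when } n_{\min}>1,\qquad\text{and}\qquad k^2\ \ge\ \frac{\lambda_1\,\eta_{\min}}{\eta_{\min}+C_T\,\lambda_1}\quad\text{when } n_{\max}<1 .$$ Here $\lambda_1$ is the first simply supported plate buckling eigenvalue for $D$, and $C_T$ is the trace theorem constant such that $\|\partial_\nu\varphi\|_{L^2(\partial D)}^2\le C_T\|\Delta\varphi\|_{L^2(D)}^2$ for all $\varphi\in X(D)$.
   Context: Setting. $D\subset\mathbb{R}^d$ ($d=2,3$) is a bounded simply connected open set with outward unit normal $\nu$, whose boundary $\partial D$ is either of class $\mathscr{C}^2$ or polygonal with no reentrant corners. The refractive index $n$ is a bounded real-valued function on $D$ with $|n-1|^{-1}\in L^\infty(D)$. The conductivity $\eta$ is a bounded real-valued function on $\partial D$ with $0<\eta_{\min}\le\eta\le\eta_{\max}$ a.e. on $\partial D$ for constants $\eta_{\min},\eta_{\max}$. Let $X(D)=H^2(D)\cap H^1_0(D)$ with norm $\|\varphi\|_{X(D)}=\|\Delta\varphi\|_{L^2(D)}$, which is equivalent to the $H^2(D)$ norm under the assumptions on $\partial D$. Transmission eigenvalue. A number $k\in\mathbb{C}$ is a transmission eigenvalue with conductive boundary condition if there is a nontrivial $u\in X(D)$ (a corresponding eigenfunction) satisfying $$(\Delta+k^2)\frac{1}{n-1}(\Delta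 u+k^2nu)=0\ \text{ in } D,\qquad -\frac{k^2}{\eta}\,\partial_\nu u=\frac{1}{n-1}(\Delta u+k^2nu)\ \text{ on }\partial D,$$ understood in the variational sense $$\int_D\frac{1}{n-1}(\Delta u+k^2nu)(\Delta\overline{\varphi}+k^2\overline{\varphi})\,dx+\int_{\partial D}\frac{k^2}{\eta}\,\partial_\nu u\,\partial_\nu\overline{\varphi}\,ds=0\quad\text{for all }\varphi\in X(D).$$ (This is the problem satisfied by $u=w-v$, where $\Delta w+k^2nw=0$, $\Delta v+k^2v=0$ in $D$, and $w-v=0$, $\partial_\nu w-\partial_\nu v=\eta v$ on $\partial D$.) Plate buckling eigenvalue. The simply supported plate buckling eigenpairs $(\lambda,\psi)$, $\lambda>0$, $0\ne\psi\in X(D)$, satisfy $\Delta^2\psi=-\lambda\Delta\psi$ in $D$ and $\Delta\psi=0$ on $\partial D$; the smallest eigenvalue is $$\lambda_1=\min_{\varphi\in X(D)\setminus\{0\}}\frac{\|\Delta\varphi\|_{L^2(D)}^2}{\|\nabla\varphi\|_{L^2(D)}^2}.$$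
   Formalization: The second bound (n_max < 1) is stated under the added assumption n_min ≥ 0, i.e. a nonnegative refractive index; it fails for negative n, e.g. on the unit disc with constant η and n = 1 − N for large N, where k² tends to 0. *)

(* Defs.v *)
From HB Require Import structures.
From mathcomp Require Import all_boot all_order all_algebra.
From mathcomp Require Import all_classical all_reals all_analysis.
From mathcomp Require Import complex.

Set Implicit Arguments.
Unset Strict Implicit.
Unset Printing Implicit Defensive.

Import Order.TTheory GRing.Theory Num.Theory.
Import numFieldNormedType.Exports.

Local Open Scope classical_set_scope.
Local Open Scope ring_scope.

(** The norm carried by ['rV[R]_d] is the sup norm; it has the right topology,
    but distances, diameters and normals need the Euclidean structure. *)
Section Euclid.
Context {R : realType} {d : nat}.
Implicit Types x y : 'rV[R]_d.

Definition dotr x y : R := \sum_(i < d) x 0 i * y 0 i.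
Definition enorm x : R := Num.sqrt (dotr x x).
Definition ediam (A : set 'rV[R]_d) : \bar R :=
  ereal_sup [set (enorm (p.1 - p.2))%:E | p in A `*` A].

End Euclid.

(** The Lebesgue and Hausdorff measures both come from Caratheodory's
    construction: countable covers weighted by a set function [zeta].  Covering
    by Borel sets only does not change either outer measure.  The maximum with 0
    in [weight0] makes it nonnegative for every [zeta]; it has no effect on the
    two weights used below. *)
Section Measures.
Context (R : realType) (d : nat).
Local Open Scope ereal_scope.

Definition borel := g_sigma_algebraType (@open 'rV[R]_d).

Definition weight0 (zeta : set 'rV[R]_d -> \bar R) (A : set 'rV[R]_d) : \bar R :=
  if `[< A = set0 >] then 0 else maxe 0 (zeta A).

Definition cover_outer (zeta : set 'rV[R]_d -> \bar R)
    : set 'rV[R]_d -> \bar R :=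
  @mu_ext _ borel R (weight0 zeta).

Lemma weight00 zeta : weight0 zeta set0 = 0.
Proof. by rewrite /weight0; case: asboolP. Qed.

Lemma weight0_ge0 zeta A : 0 <= weight0 zeta A.
Proof. by rewrite /weight0; case: asboolP => // _; rewrite le_max lexx. Qed.

Lemma cover_outer0 zeta : cover_outer zeta set0 = 0.
Proof. exact: (@mu_ext0 _ borel R _ (weight00 zeta) (weight0_ge0 zeta)). Qed.

Lemma cover_outer_ge0 zeta A : 0 <= cover_outer zeta A.
Proof. exact: (@mu_ext_ge0 _ borel R _ (weight0_ge0 zeta) A). Qed.

Lemma le_cover_outer zeta : {homo cover_outer zeta : A B / A `<=` B >-> A <= B}.
Proof. by move=> A B; exact: (@le_mu_ext _ borel R). Qed.

Lemma cover_outer_sigma_subadditive zeta : sigma_subadditive (cover_outer zeta).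
Proof. exact: (@mu_ext_sigma_subadditive _ borel R _ (weight0_ge0 zeta)). Qed.

(** Smallest volume of a box containing [A]. *)
Definition box_volume (A : set 'rV[R]_d) : \bar R :=
  ereal_inf [set (\prod_(i < d) (p.2 0%R i - p.1 0%R i))%R%:E
    | p in [set p : 'rV[R]_d * 'rV[R]_d |
        (forall i, p.1 0%R i <= p.2 0%R i)%R /\
        A `<=` [set x | forall i, (p.1 0%R i <= x 0%R i <= p.2 0%R i)%R]]].

Definition leb_outer : set 'rV[R]_d -> \bar R := cover_outer box_volume.

HB.instance Definition _ := isOuterMeasure.Build R 'rV[R]_d leb_outer
  (cover_outer0 _) (cover_outer_ge0 _) (@le_cover_outer _)
  (@cover_outer_sigma_subadditive _).

(** The volume of the unit ball of R^s satisfies w_(s+2) = 2 pi w_s / (s+2). *)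
Fixpoint ball_volume (s : nat) : R :=
  match s with
  | 0%N => 1
  | 1%N => 2
  | s'.+2 => (2 * pi / s'.+2%:R * ball_volume s')%R
  end.

Definition diam_weight (s : nat) (delta : R) (A : set 'rV[R]_d) : \bar R :=
  if ediam A <= delta%:E
  then (ball_volume s * (fine (ediam A) / 2) ^+ s)%R%:E else +oo.

(** s-dimensional Hausdorff outer measure, normalised so that it is the usual
    s-dimensional area on s-dimensional surfaces. *)
Definition hausdorff_outer (s : nat) (A : set 'rV[R]_d) : \bar R :=
  ereal_sup [set cover_outer (diam_weight s delta) A
            | delta in [set delta : R | (0 < delta)%R]].

Lemma hausdorff_outer_ub s (delta : R) A : (0 < delta)%R ->
  cover_outer (diam_weight s delta) A <= hausdorff_outer s A.
Proof. by move=> d0; apply: ereal_sup_ubound; exists delta. Qed.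

Lemma hausdorff_outer_ge0 s A : 0 <= hausdorff_outer s A.
Proof. by apply: le_trans (hausdorff_outer_ub s A ltr01); exact: cover_outer_ge0. Qed.

Lemma hausdorff_outer0 s : hausdorff_outer s set0 = 0.
Proof.
apply/eqP; rewrite eq_le hausdorff_outer_ge0 andbT.
by apply: ge_ereal_sup => _ [delta _ <-]; rewrite cover_outer0.
Qed.

Lemma le_hausdorff_outer s :
  {homo hausdorff_outer s : A B / A `<=` B >-> A <= B}.
Proof.
move=> A B AB; apply: ge_ereal_sup => _ [delta d0 <-].
by apply: le_trans (hausdorff_outer_ub s B d0); exact: le_cover_outer.
Qed.

Lemma hausdorff_outer_sigma_subadditive s :
  sigma_subadditive (hausdorff_outer s).
Proof.
move=> F; apply: ge_ereal_sup => _ [delta d0 <-].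
apply: (le_trans (cover_outer_sigma_subadditive _ _)).
apply: lee_nneseries => [i _ _|i _]; first exact: cover_outer_ge0.
exact: hausdorff_outer_ub.
Qed.

HB.instance Definition _ s := isOuterMeasure.Build R 'rV[R]_d
  (hausdorff_outer s) (hausdorff_outer0 s) (hausdorff_outer_ge0 s)
  (@le_hausdorff_outer s) (@hausdorff_outer_sigma_subadditive s).

(** [leb] is defined on the Lebesgue measurable sets, [surf] on the
    H^(d-1)-measurable sets; both sigma-algebras contain the Borel sets. *)
Definition lebT := caratheodory_type leb_outer.
HB.instance Definition _ := Measurable.on lebT.
Definition leb : set lebT -> \bar R := leb_outer.
HB.instance Definition _ := isMeasure.Build _ lebT R leb
  (@caratheodory_measure0 R 'rV[R]_d leb_outer)
  (@caratheodory_measure_ge0 R 'rV[R]_d leb_outer)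
  (@caratheodory_measure_sigma_additive R 'rV[R]_d leb_outer).

Definition surfT := caratheodory_type (hausdorff_outer d.-1).
HB.instance Definition _ := Measurable.on surfT.
Definition surf : set surfT -> \bar R := hausdorff_outer d.-1.
HB.instance Definition _ := isMeasure.Build _ surfT R surf
  (@caratheodory_measure0 R 'rV[R]_d (hausdorff_outer d.-1))
  (@caratheodory_measure_ge0 R 'rV[R]_d (hausdorff_outer d.-1))
  (@caratheodory_measure_sigma_additive R 'rV[R]_d (hausdorff_outer d.-1)).

End Measures.
Arguments leb R d A : clear implicits.
Arguments surf R d A : clear implicits.

Section Domain.
Context {R : realType}.

Let I01 : set R := [set t | 0 <= t <= 1].

Definition path_connected {T : topologicalType} (A : set T) : Prop :=
  forall x y, A x -> A y ->
  exists gamma : R -> T,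
    [/\ {within I01, continuous gamma},
        gamma 0 = x, gamma 1 = y & gamma @` I01 `<=` A].

Definition loops_contractible {T : topologicalType} (A : set T) : Prop :=
  forall gamma : R -> T,
    {within I01, continuous gamma} -> gamma @` I01 `<=` A ->
    gamma 0 = gamma 1 ->
  exists (H : R * R -> T) (c : T),
    [/\ {within I01 `*` I01, continuous H},
        H @` (I01 `*` I01) `<=` A,
        forall t, I01 t -> H (0, t) = gamma t,
        forall t, I01 t -> H (1, t) = c
      & forall s, I01 s -> H (s, 0) = H (s, 1)].

Definition simply_connected {T : topologicalType} (A : set T) : Prop :=
  path_connected A /\ loops_contractible A.

Context {d : nat}.
Implicit Types (D : set 'rV[R]_d) (f : 'rV[R]_d -> R).

Definition bdry D : set 'rV[R]_d := closure D `\` interior D.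

Definition partial (i : 'I_d) f (x : 'rV[R]_d) : R := 'D_(delta_mx 0 i) f x.

Definition grad f (x : 'rV[R]_d) : 'rV[R]_d := \row_i partial i f x.

Fixpoint Ck (k : nat) f : Prop :=
  match k with
  | 0%N => continuous f
  | k'.+1 => forall i, (forall x, derivable f x (delta_mx 0 i)) /\
                       Ck k' (partial i f)
  end.

Definition smooth f : Prop := forall k, Ck k f.

(** Near each boundary point, D is a sublevel set of a C^2 function with
    nonvanishing gradient. *)
Definition C2_boundary D : Prop :=
  forall x, bdry D x ->
  exists rho : 'rV[R]_d -> R,
    [/\ Ck 2 rho, grad rho x <> 0 & \forall y \near x, D y <-> rho y < 0].

(** Near each boundary point, D is a convex polyhedral cone, i.e. an
    intersection of finitely many open half-spaces whose boundaries pass through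
    that point: the boundary is polygonal (polyhedral if d = 3), and convexity of
    the cones says that no corner (or edge) is reentrant. *)
Definition polygonal_nonreentrant D : Prop :=
  forall x, bdry D x ->
  exists N : seq 'rV[R]_d,
    (forall a, a \in N -> a <> 0) /\
    \forall y \near x, D y <-> (forall a, a \in N -> dotr a (y - x) < 0).

(** v is the outward unit normal at the boundary point x: D is tangent at x to
    the half-space {y | (y - x) . v < 0}. *)
Definition is_outward_normal D (x v : 'rV[R]_d) : Prop :=
  dotr v v = 1 /\
  forall e : R, 0 < e -> \forall y \near x,
    (dotr (y - x) v < - (e * enorm (y - x)) -> D y) /\
    (e * enorm (y - x) < dotr (y - x) v -> ~ D y).

(** The normal is 0 at the corners and edges of a polygonal D, a null set for
    the surface measure. *)
Definition normal D (x : 'rV[R]_d) : 'rV[R]_d :=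
  xget 0 [set v | is_outward_normal D x v].

Definition L2 D f : Prop :=
  measurable_fun (D : set (lebT R d)) (f : lebT R d -> R) /\
  (\int[leb R d]_(x in D) ((f x) ^+ 2)%:E < +oo)%E.

Definition L2b D f : Prop :=
  measurable_fun (bdry D : set (surfT R d)) (f : surfT R d -> R) /\
  (\int[surf R d]_(x in bdry D) ((f x) ^+ 2)%:E < +oo)%E.

Definition test_function D f : Prop :=
  [/\ smooth f, compact (closure [set x | f x != 0])
    & closure [set x | f x != 0] `<=` D].

Definition is_wpartial D (i : 'I_d) f g : Prop :=
  L2 D g /\
  forall phi, test_function D phi ->
    \int[leb R d]_(x in D) (f x * partial i phi x) =
    - \int[leb R d]_(x in D) (g x * phi x).

(** Weak partial derivatives are unique up to null sets; [wpartial] selects a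
    representative (and is 0 when there is none). *)
Definition wpartial D (i : 'I_d) f : 'rV[R]_d -> R :=
  xget (fun=> 0) [set g | is_wpartial D i f g].

Definition H1 D f : Prop :=
  L2 D f /\ forall i, exists g, is_wpartial D i f g.

Definition H2 D f : Prop :=
  H1 D f /\ forall i j, exists g, is_wpartial D j (wpartial D i f) g.

Definition sqdist_L2 D f g : \bar R :=
  (\int[leb R d]_(x in D) ((f x - g x) ^+ 2)%:E)%E.

Definition sqdist_H1 D f phi : \bar R :=
  (sqdist_L2 D f phi +
   \sum_(i < d) sqdist_L2 D (wpartial D i f) (partial i phi))%E.

Definition sqdist_H2 D f phi : \bar R :=
  (sqdist_H1 D f phi +
   \sum_(i < d) \sum_(j < d)
      sqdist_L2 D (wpartial D j (wpartial D i f)) (partial j (partial i phi)))%E.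

Definition H10 D f : Prop :=
  H1 D f /\
  forall e : R, 0 < e ->
  exists phi, test_function D phi /\ (sqdist_H1 D f phi < e%:E)%E.

Definition wlaplacian D f (x : 'rV[R]_d) : R :=
  \sum_(i < d) wpartial D i (wpartial D i f) x.

(** The trace of the normal derivative of f in H^2(D): the limit in
    L^2(bdry D) of the classical normal derivatives of smooth functions
    converging to f in H^2(D). *)
Definition is_normal_derivative D f g : Prop :=
  L2b D g /\
  forall e : R, 0 < e ->
  exists phi, [/\ smooth phi, (sqdist_H2 D f phi < e%:E)%E
    & (\int[surf R d]_(x in bdry D)
         ((dotr (normal D x) (grad phi x) - g x) ^+ 2)%:E < e%:E)%E].

Definition normal_derivative D f : 'rV[R]_d -> R :=
  xget (fun=> 0) [set g | is_normal_derivative D f g].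

End Domain.
Arguments simply_connected R {T} A.

(** Weak derivatives, traces and integrals of complex-valued functions are taken
    on real and imaginary parts. *)
Section Complex.
Context {R : realType} {d : nat}.
Local Open Scope complex_scope.
Implicit Types (D : set 'rV[R]_d) (u phi : 'rV[R]_d -> R[i]).

Definition re u : 'rV[R]_d -> R := fun x => complex.Re (u x).
Definition im u : 'rV[R]_d -> R := fun x => complex.Im (u x).

Definition sqmod (z : R[i]) : R := complex.Re z ^+ 2 + complex.Im z ^+ 2.

Definition cplx (T : ('rV[R]_d -> R) -> 'rV[R]_d -> R) u : 'rV[R]_d -> R[i] :=
  fun x => T (re u) x +i* T (im u) x.

Definition lap D u := cplx (wlaplacian D) u.
Definition pd D (i : 'I_d) u := cplx (wpartial D i) u.
Definition dnu D u := cplx (normal_derivative D) u.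

Definition int_dom D u : R[i] :=
  (\int[leb R d]_(x in D) re u x) +i* (\int[leb R d]_(x in D) im u x).
Definition int_bdry D u : R[i] :=
  (\int[surf R d]_(x in bdry D) re u x) +i*
  (\int[surf R d]_(x in bdry D) im u x).

Definition sqnorm_dom D u : R := \int[leb R d]_(x in D) sqmod (u x).
Definition sqnorm_bdry D u : R := \int[surf R d]_(x in bdry D) sqmod (u x).

Definition X D u : Prop :=
  (H2 D (re u) /\ H10 D (re u)) /\ (H2 D (im u) /\ H10 D (im u)).

Definition nontrivial D u : Prop :=
  ~ {ae leb R d, forall x, D x -> u x = 0}.

Definition transmission_eigenvalue D (n eta : 'rV[R]_d -> R) (k : R[i]) : Prop :=
  exists u, [/\ X D u, nontrivial D u &
    forall phi, X D phi ->
      int_dom D (fun x => ((n x - 1)^-1)%:C *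
                          (lap D u x + k ^+ 2 * (n x)%:C * u x) *
                          ((lap D phi x)^* + k ^+ 2 * (phi x)^*)) +
      int_bdry D (fun x => k ^+ 2 / (eta x)%:C * dnu D u x * (dnu D phi x)^*)
      = 0].

(** Variational form of  Delta^2 psi = - lambda Delta psi  in D,
    psi = Delta psi = 0  on the boundary. *)
Definition buckling_eigenvalue D (lambda : R) : Prop :=
  0 < lambda /\
  exists psi, [/\ X D psi, nontrivial D psi &
    forall phi, X D phi ->
      int_dom D (fun x => lap D psi x * (lap D phi x)^*) =
      lambda%:C *
        \sum_(i < d) int_dom D (fun x => pd D i psi x * (pd D i phi x)^*)].

Definition rayleigh D phi : R :=
  sqnorm_dom D (lap D phi) / \sum_(i < d) sqnorm_dom D (pd D i phi).

Definition rayleigh_values D : set R :=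
  [set rayleigh D phi | phi in [set phi | X D phi /\ nontrivial D phi]].

(** The last two clauses say that lambda1 is the minimum of the Rayleigh
    quotient over X(D) \ {0}; they imply the first two, a minimiser being an
    eigenfunction. *)
Definition first_buckling_eigenvalue D (lambda1 : R) : Prop :=
  [/\ buckling_eigenvalue D lambda1,
      forall lambda, buckling_eigenvalue D lambda -> lambda1 <= lambda,
      rayleigh_values D lambda1
    & lbound (rayleigh_values D) lambda1].

(** |n - 1|^-1 in L^oo(D): in particular n <> 1 almost everywhere, which the
    convention 0^-1 = 0 would lose in a bound on the inverse. *)
Definition refractive_index D (n : 'rV[R]_d -> R) : Prop :=
  [/\ measurable_fun (D : set (lebT R d)) (n : lebT R d -> R),
      exists M : R, forall x, D x -> `|n x| <= M
    & exists c : R, 0 < c /\ {ae leb R d, forall x, D x -> c <= `|n x - 1|}].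

Definition conductivity D (eta : 'rV[R]_d -> R) (etamin etamax : R) : Prop :=
  [/\ measurable_fun (bdry D : set (surfT R d)) (eta : surfT R d -> R),
      exists M : R, forall x, bdry D x -> `|eta x| <= M,
      0 < etamin
    & {ae surf R d, forall x, bdry D x -> etamin <= eta x <= etamax}].

Definition trace_constant D (CT : R) : Prop :=
  forall phi, X D phi ->
    sqnorm_bdry D (dnu D phi) <= CT * sqnorm_dom D (lap D phi).

End Complex.

(* Main.v *)
(** Test the variational equation with [phi = u] and take real parts.  Writing
    [L] for the Laplacian of [u] and [U = k^2 u], the interior integrand satisfies
    pointwise, up to taking real parts,
<<
      (L + n U) (L + U)^* / (n - 1) = |L|^2 / n + L U^* + |L + n U|^2 / (n (n - 1))
                                    = - |L|^2 - L U^* - n |L + U|^2 / (1 - n),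
>>
    and Green's formula turns the integral of [L U^*] into [- k^2 |grad u|^2].
    For [n > 1] the first form gives [|L|^2 / nmax <= k^2 |grad u|^2], since the
    boundary term is nonnegative.  For [0 <= n < 1] the second form gives
    [|L|^2 - k^2 |grad u|^2 <= k^2 / etamin |d_nu u|^2 <= k^2 CT / etamin |L|^2].
    The Rayleigh quotient bound [lambda1 |grad u|^2 <= |L|^2] concludes.

    Green's formula follows by approximating [u] in H^1 by test functions.  To
    manipulate these integrals one needs continuous functions, and the boundary
    of [D], to be measurable, i.e. open sets to be Caratheodory measurable for
    the Lebesgue and the Hausdorff outer measures. *)

Require Import Defs.
From mathcomp Require Import all_boot all_order all_algebra.
From mathcomp Require Import all_classical all_reals all_analysis.
From mathcomp Require Import complex measurable_realfun ring lra.

Import Order.TTheory GRing.Theory Num.Theory.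
Import numFieldNormedType.Exports.

Set Implicit Arguments.
Unset Strict Implicit.
Unset Printing Implicit Defensive.

Local Open Scope classical_set_scope.
Local Open Scope ring_scope.

(** * Measurability of open sets *)

Section Halfspaces.
Context {R : realType} {d : nat}.
Implicit Types (A C H K : set 'rV[R]_d) (zeta : set 'rV[R]_d -> \bar R).

(** Intersecting a cover of [A] termwise with [H] and with [K] covers both pieces of [A]. Borel
    measurability keeps the cut sets admissible, and the inequality on weights passes to the series
    and then to the infimum. *)
Lemma cover_outer_split zeta A H K :
  measurable (H : set (borel R d)) -> measurable (K : set (borel R d)) ->
  (forall C, weight0 zeta (C `&` H) + weight0 zeta (C `&` K) <= weight0 zeta C)%E ->
  (cover_outer zeta (A `&` H) + cover_outer zeta (A `&` K) <= cover_outer zeta A)%E.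
Proof.
move=> mH mK split_w; apply: le_ereal_inf_tmp => _ [F [mF AF] <-].
have le_cover L : measurable (L : set (borel R d)) ->
    (cover_outer zeta (A `&` L) <= \sum_(k <oo) weight0 zeta (F k `&` L))%E.
  move=> mL; apply: ereal_inf_lbound; exists (fun k => F k `&` L) => //; split.
    by move=> k; apply: measurableI => //; exact: mF.
  by move=> x [/AF[k _ Fkx] Lx]; exists k.
apply: le_trans (leeD (le_cover _ mH) (le_cover _ mK)) _.
rewrite -nneseriesD; try by move=> *; exact: weight0_ge0.
apply: lee_nneseries => [k _ _|k _]; last exact: split_w.
by apply: adde_ge0; exact: weight0_ge0.
Qed.

Lemma open_halfspace_lt (i : 'I_d) (a : R) : open [set x : 'rV[R]_d | x 0 i < a].
Proof.
have -> : [set x : 'rV[R]_d | x 0 i < a] =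
    (fun x : 'rV[R]_d => x 0 i) @^-1` [set t | t < a] by [].
by apply: open_comp; [move=> x _; exact: coord_continuous|exact: open_lt].
Qed.

Lemma open_halfspace_gt (i : 'I_d) (a : R) : open [set x : 'rV[R]_d | a < x 0 i].
Proof.
have -> : [set x : 'rV[R]_d | a < x 0 i] =
    (fun x : 'rV[R]_d => x 0 i) @^-1` [set t | a < t] by [].
by apply: open_comp; [move=> x _; exact: coord_continuous|exact: open_gt].
Qed.

Lemma halfspace_setC (i : 'I_d) (a : R) :
  ~` [set x : 'rV[R]_d | x 0 i < a] = [set x | a <= x 0 i].
Proof. by apply/seteqP; split=> x /=; rewrite leNgt => /negP. Qed.

Lemma halfspace_le_setC (i : 'I_d) (a : R) :
  ~` [set x : 'rV[R]_d | a < x 0 i] = [set x | x 0 i <= a].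
Proof. by apply/seteqP; split=> x /=; rewrite leNgt => /negP. Qed.

Lemma borel_open (U : set 'rV[R]_d) : open U -> measurable (U : set (borel R d)).
Proof. by move=> oU; exact: sub_gen_smallest. Qed.

Lemma box_volume_split (i : 'I_d) (a : R) C :
  (box_volume (C `&` [set x : 'rV[R]_d | x 0 i < a]%R) +
   box_volume (C `&` [set x : 'rV[R]_d | a <= x 0 i]%R) <= box_volume C)%E.
Proof.
apply: le_ereal_inf_tmp => _ [[p q] /= [pq Cpq] <-].
(* [m] is [a] clamped to the [i]-th side of the box. If the hyperplane misses the box, one of the
   two halves degenerates to volume 0 and the volumes still add up. *)
set m := Num.max (p 0 i) (Num.min a (q 0 i)).
pose q' : 'rV[R]_d := \row_j (if j == i then m else q 0 j).
pose p' : 'rV[R]_d := \row_j (if j == i then m else p 0 j).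
have pm : p 0 i <= m by rewrite /m le_max lexx.
have mq : m <= q 0 i by rewrite /m ge_max pq ge_min lexx orbT.
have -> : \prod_(j < d) (q 0 j - p 0 j) =
    \prod_(j < d) (q' 0 j - p 0 j) + \prod_(j < d) (q 0 j - p' 0 j).
  have -> : \prod_(j < d) (q' 0 j - p 0 j) =
      (m - p 0 i) * \prod_(j < d | j != i) (q 0 j - p 0 j).
    rewrite (bigD1 i)//= mxE eqxx; congr (_ * _).
    by apply: eq_bigr => j /negPf ji; rewrite mxE ji.
  have -> : \prod_(j < d) (q 0 j - p' 0 j) =
      (q 0 i - m) * \prod_(j < d | j != i) (q 0 j - p 0 j).
    rewrite (bigD1 i)//= mxE eqxx; congr (_ * _).
    by apply: eq_bigr => j /negPf ji; rewrite mxE ji.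
  by rewrite (bigD1 i)//= -mulrDl [m - _ + _]addrC subrKA.
rewrite EFinD; apply: leeD; apply: ereal_inf_lbound.
- exists (p, q') => //=; split.
    by move=> j; rewrite mxE; case: eqP => [->//|_]; exact: pq.
  move=> x [Cx xa] j; have /andP[px xq] := Cpq _ Cx j; rewrite mxE px /=.
  case: eqP => [ji|//]; rewrite /= in xa; subst j.
  by rewrite /m le_max le_min (ltW xa) xq orbT.
- exists (p', q) => //=; split.
    by move=> j; rewrite mxE; case: eqP => [->//|_]; exact: pq.
  move=> x [Cx xa] j; have /andP[px xq] := Cpq _ Cx j; rewrite mxE xq andbT.
  case: eqP => [ji|//]; rewrite /= in xa; subst j.
  by rewrite /m ge_max px ge_min xa.
Qed.

Lemma box_volume_ge0 A : (0 <= box_volume A)%E.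
Proof.
apply: le_ereal_inf_tmp => _ [[p q] /= [pq _] <-].
by rewrite lee_fin; apply: prodr_ge0 => i _; rewrite subr_ge0.
Qed.

Lemma leb_outer_halfspace (i : 'I_d) (a : R) :
  (@leb_outer R d).-caratheodory [set x : 'rV[R]_d | x 0 i < a].
Proof.
apply: le_caratheodory_measurable => A; rewrite halfspace_setC.
apply: cover_outer_split; first by apply: borel_open; exact: open_halfspace_lt.
  rewrite -halfspace_setC; apply: measurableC.
  by apply: borel_open; exact: open_halfspace_lt.
move=> C; have le_w B : (weight0 (@box_volume R d) B <= box_volume B)%E.
  rewrite /weight0; case: asboolP => _; first exact: box_volume_ge0.
  by rewrite ge_max box_volume_ge0 lexx.
have [->|/eqP C0] := eqVneq C set0; first by rewrite !set0I !weight00 adde0.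
rewrite [leRHS]/weight0; case: asboolP => // _.
rewrite max_r ?box_volume_ge0//.
by apply: le_trans (box_volume_split i a C); exact: leeD.
Qed.

End Halfspaces.
(* Caratheodory's criterion.  With [r k] increasing to [c], the layers
   [r k < g <= r k.+1] of odd (resp. even) index are separated from each other, so
   the sum of their measures is at most [2 mu X]; hence its tail, which bounds the
   measure of the part of [X] where [r N < g < c], tends to 0. *)
Lemma caratheodory_sublevel (R : realType) (T : Type)
    (mu : {outer_measure set T -> \bar R}) (g : T -> R) :
  (forall (A : set T) (a b : R), a < b ->
    (mu (A `&` [set x | g x <= a]%R) + mu (A `&` [set x | b <= g x]%R) <= mu A)%E) ->
  forall c, mu.-caratheodory [set x | g x < c]%R.
Proof.
move=> sep c; apply: le_caratheodory_measurable => X.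
have [->|Xoo] := eqVneq (mu X) +oo%E; first by rewrite leey.
pose r n : R := c - n.+1%:R^-1.
have rS n : r n < r n.+1.
  by rewrite ler_ltB// ltf_pV2 ?posrE ?ltr0n// ltr_nat.
have rc n : r n < c by rewrite ltrBlDr ltrDl invr_gt0 ltr0n.
pose E n := X `&` [set x | g x <= r n].
pose layer n := X `&` [set x | r n < g x <= r n.+1].
have muE n : (mu (E n) <= mu X)%E by apply: le_outer_measure => x [].
(* Two consecutive sets [E] on the right treat both parities in one induction: [layer n.+1] and
   [E n] are separated by the gap from [r n] to [r n.+1], and both lie in [E n.+2]. *)
have sum_layer n : (\sum_(0 <= k < n) mu (layer k.+1) <= mu (E n.+1) + mu (E n))%E.
  elim: n => [|n IH]; first by rewrite big_geq// adde_ge0// outer_measure_ge0.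
  rewrite big_nat_recr//=; apply: le_trans (leeD IH (lexx _)) _.
  rewrite -addeA [leRHS]addeC leeD//.
  apply: le_trans (sep (E n.+2) _ _ (rS n)); apply: leeD; apply: le_outer_measure.
    by move=> x [Xx /= gx]; do !split => //=; apply: le_trans gx _;
       apply/ltW/(lt_trans (rS n)).
  by move=> x [Xx /= /andP[/ltW gx gx']]; do !split.
have layer_ge0 k : (0 <= mu (layer k.+1))%E by exact: outer_measure_ge0.
have tail0 : (\sum_(N <= k <oo) mu (layer k.+1))%E @[N --> \oo] --> 0%E.
  apply: nneseries_tail_cvg => //; apply: (@le_lt_trans _ _ (mu X + mu X)%E).
    apply: lime_le; first exact: is_cvg_nneseries.
    by apply: nearW => n; apply: le_trans (sum_layer n) _; exact: leeD.
  by rewrite lte_add_pinfty// ltey.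
have tail_bound N : (mu (X `&` [set x | g x < c]%R) + mu (X `&` ~` [set x | g x < c]%R)
    <= mu X + \sum_(N <= k <oo) mu (layer k.+1))%E.
  have -> : ~` [set x | g x < c]%R = [set x | c <= g x].
    by apply/seteqP; split=> x /=; rewrite leNgt => /negP.
  apply: le_trans (leeD (sep X _ _ (rc N.+1)) (lexx _)).
  rewrite addeAC; apply: leeD => //.
  apply: le_trans (leeD (lexx _) (outer_measure_sigma_subadditive_tail mu N _)).
  apply: le_trans (outer_measureU2 _ _ _); apply: le_outer_measure => x [Xx /= gc].
  have [gx|gx] := leP (g x) (r N.+1); first by left.
  have ex_r : exists m, g x <= r m.
    have cg0 : 0 < c - g x by rewrite subr_gt0.
    have [m _ /(_ m (leqnn m))/= mc] := near_infty_natSinv_lt (PosNum cg0).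
    by exists m; rewrite /r lerBrDl -lerBrDr ltW.
  case: (ex_minnP ex_r) => m gm m_min; right.
  have Nm : (N.+1 < m)%N.
    rewrite ltnNge; apply/negP => mN; move: gx; apply/negP; rewrite -leNgt.
    apply: le_trans gm _; rewrite lerB// lef_pV2 ?posrE ?ltr0n//.
    by rewrite ler_nat ltnS.
  (* The least index has the form [m.+2] with [N <= m], so [x] lies in [layer m.+1], a term of the
     tail; minimality gives the strict lower bound. *)
  case: m Nm gm m_min => [//|[//|m]] Nm gm m_min.
  exists m; first by apply/negP; rewrite -leqNgt -ltnS -ltnS.
  split => //=; rewrite gm andbT ltNge; apply/negP => /m_min.
  by rewrite ltnn.
apply/lee_addgt0Pr => e e0.
have e0' : (0%:E < e%:E)%E by rewrite lte_fin.
have [N _ /(_ N (leqnn N))/= /ltW tailN] := tail0 _ (open_ereal_lt' e0').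
by apply: le_trans (tail_bound N) _; exact: leeD.
Qed.

(** * Half-spaces and the Hausdorff outer measures *)

Section Hausdorff.
Context {R : realType} {d : nat}.
Implicit Types (A B C : set 'rV[R]_d).

Lemma le_enorm (x : 'rV[R]_d) (i : 'I_d) : x 0 i <= enorm x.
Proof.
apply: le_trans (ler_norm _) _; rewrite -sqrtr_sqr /enorm; apply: ler_wsqrtr.
rewrite /dotr (bigD1 i)//= -expr2 lerDl; apply: sumr_ge0 => j _.
by rewrite -expr2 sqr_ge0.
Qed.

Lemma ball_volume_ge0 s : 0 <= ball_volume R s.
Proof.
elim/ltn_ind: s => -[|[|s]] IH //=.
by rewrite mulr_ge0 ?IH// divr_ge0// mulr_ge0// pi_ge0.
Qed.

Lemma ediam_ge A (x y : 'rV[R]_d) : A x -> A y -> ((enorm (x - y))%:E <= ediam A)%E.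
Proof. by move=> Ax Ay; apply: ereal_sup_ubound; exists (x, y). Qed.

Lemma le_weight0_diam s (delta : R) A B : A `<=` B ->
  (weight0 (diam_weight s delta) A <= weight0 (diam_weight s delta) B)%E.
Proof.
move=> AB; rewrite {1}/weight0; case: asboolP => [_|A0]; first exact: weight0_ge0.
(* A point of [A] makes its diameter nonnegative; the supremum defining [ediam set0] is -oo. *)
have /set0P[x Ax] : A != set0 by apply/eqP.
rewrite /weight0; case: asboolP => [B0|_]; first by move: (AB _ Ax); rewrite B0.
rewrite ge_max le_max lexx /= le_max; apply/orP; right.
have ediamAB : (ediam A <= ediam B)%E.
  by apply: ereal_sup_le => _ [p [Ap1 Ap2] <-]; exists p => //; split; exact: AB.
have ediamA0 : (0 <= ediam A)%E.
  by apply: le_trans (ediam_ge Ax Ax); rewrite lee_fin sqrtr_ge0.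
rewrite /diam_weight; have [Bd|_] := boolP (ediam B <= delta%:E)%E; last by rewrite leey.
rewrite (le_trans ediamAB Bd) lee_fin ler_wpM2l ?ball_volume_ge0// lerXn2r ?nnegrE//.
- by rewrite divr_ge0// fine_ge0.
- by rewrite divr_ge0// fine_ge0// (le_trans ediamA0).
rewrite ler_pM2r ?invr_gt0// fine_le// ge0_fin_numE ?(le_trans ediamA0)//.
  by apply: le_lt_trans (le_trans ediamAB Bd) _; rewrite ltry.
by apply: le_lt_trans Bd _; rewrite ltry.
Qed.

(* A set of diameter at most [delta] cannot meet both half-spaces. *)
Lemma cover_outer_diam_separated s (delta : R) (i : 'I_d) (a b : R) A :
  delta < b - a ->
  (cover_outer (diam_weight s delta) (A `&` [set x : 'rV[R]_d | x 0 i <= a]%R) +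
   cover_outer (diam_weight s delta) (A `&` [set x : 'rV[R]_d | b <= x 0 i]%R)
   <= cover_outer (diam_weight s delta) A)%E.
Proof.
move=> dab; apply: cover_outer_split.
- rewrite -halfspace_le_setC; apply: measurableC.
  by apply: borel_open; exact: open_halfspace_gt.
- rewrite -halfspace_setC; apply: measurableC.
  by apply: borel_open; exact: open_halfspace_lt.
move=> C; set H := [set x | _]; set K := [set x | _].
have le_w L : (weight0 (diam_weight s delta) (C `&` L) <=
    weight0 (diam_weight s delta) C)%E by apply: le_weight0_diam => x [].
have [->|/set0P[x [Cx Hx]]] := eqVneq (C `&` H) set0.
  by rewrite weight00 add0e.
have [->|/set0P[y [Cy Ky]]] := eqVneq (C `&` K) set0.
  by rewrite weight00 adde0.
suff -> : weight0 (diam_weight s delta) C = +oo%E by rewrite leey.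
rewrite /weight0; case: asboolP => [C0|_]; first by move: Cx; rewrite C0.
rewrite /diam_weight ifF ?maxey//; apply/negP => /(le_trans (ediam_ge Cy Cx)).
rewrite lee_fin leNgt => /negP; apply; apply: lt_le_trans dab _.
apply: le_trans (le_enorm _ i); rewrite !mxE; apply: lerB; [exact: Ky|exact: Hx].
Qed.

Lemma le_cover_outer_weight (z z' : set 'rV[R]_d -> \bar R) A :
  (forall B, weight0 z B <= weight0 z' B)%E ->
  (cover_outer z A <= cover_outer z' A)%E.
Proof.
move=> zz'; apply: le_ereal_inf_tmp => _ [F [mF AF] <-].
apply: (@le_trans _ _ (\sum_(k <oo) weight0 z (F k))%E).
  by apply: ereal_inf_lbound; exists F.
by apply: lee_nneseries => // k _ _; exact: weight0_ge0.
Qed.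

(** A smaller [delta] only sends more weights to +oo. Hence the supremum over [delta] in the
    Hausdorff measure is approached by all sufficiently small [delta]. *)
Lemma cover_outer_diam_anti s (delta delta' : R) A : delta <= delta' ->
  (cover_outer (diam_weight s delta') A <= cover_outer (diam_weight s delta) A)%E.
Proof.
move=> dd'; apply: le_cover_outer_weight => B; rewrite /weight0; case: asboolP => // _.
rewrite ge_max le_max lexx /= le_max; apply/orP; right.
rewrite /diam_weight; have [Bd|_] := boolP (ediam B <= delta%:E)%E; last by rewrite leey.
by case: ifPn => // /negP[]; apply: le_trans Bd _; rewrite lee_fin.
Qed.

(** Each piece almost reaches its supremum at some scale, [d1] or [d2]. By monotonicity in the
    scale, a common scale below [d1], [d2] and the gap [b - a] serves both, and at that scale no set
    of finite weight meets both pieces. *)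
Lemma hausdorff_outer_separated s (i : 'I_d) (a b : R) A : a < b ->
  (hausdorff_outer s (A `&` [set x : 'rV[R]_d | x 0 i <= a]%R) +
   hausdorff_outer s (A `&` [set x : 'rV[R]_d | b <= x 0 i]%R)
   <= hausdorff_outer s A)%E.
Proof.
move=> ab; set H := [set x | _]; set K := [set x | _].
have [->|Aoo] := eqVneq (hausdorff_outer s A) +oo%E; first by rewrite leey.
have fin L : hausdorff_outer s (A `&` L) \is a fin_num.
  rewrite ge0_fin_numE ?hausdorff_outer_ge0//.
  by apply: le_lt_trans (le_hausdorff_outer s (@subIsetl _ A L)) _; rewrite ltey.
apply/lee_addgt0Pr => e e0; have e20 : 0 < e / 2 by rewrite divr_gt0.
have [_ [d1 /= d10 <-] Hd1] := ub_ereal_sup_adherent e20 (fin H).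
have [_ [d2 /= d20 <-] Kd2] := ub_ereal_sup_adherent e20 (fin K).
pose d0 := Num.min ((b - a) / 2) (Num.min d1 d2).
have ab0 : 0 < b - a by rewrite subr_gt0.
have d00 : 0 < d0 by rewrite !lt_min d10 d20 divr_gt0.
have d0ab : d0 < b - a by rewrite gt_min ltr_pdivrMr// mulr_natr mulr2n ltrDl ab0.
have := cover_outer_diam_separated s i A d0ab.
move=> /le_trans/(_ (hausdorff_outer_ub s A d00)) sepA.
have d01 : d0 <= d1 by rewrite !ge_min lexx !orbT.
have d02 : d0 <= d2 by rewrite !ge_min lexx !orbT.
move: Hd1 Kd2; rewrite !EFinN !lteBlDr// => /ltW Hd1 /ltW Kd2.
apply: le_trans (leeD Hd1 Kd2) _; rewrite addeACA -EFinD -splitr.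
apply: leeD; last exact: lexx.
apply: le_trans sepA; apply: leeD.
  exact: (cover_outer_diam_anti s (A `&` H) d01).
exact: (cover_outer_diam_anti s (A `&` K) d02).
Qed.

Lemma hausdorff_outer_halfspace s (i : 'I_d) (a : R) :
  (@hausdorff_outer R d s).-caratheodory [set x : 'rV[R]_d | x 0 i < a].
Proof.
apply: (@caratheodory_sublevel _ _ (@hausdorff_outer R d s) (fun x => x 0 i)).
by move=> A a' b' ab; exact: hausdorff_outer_separated.
Qed.

End Hausdorff.

(** * From half-spaces to open sets *)

Section OpenMeasurable.
Context {R : realType} {d : nat}.

(** Rational corners make the family countable. The half-open form lets each box be built from the
    half-spaces [x 0 i < a] and their complements alone. *)
Definition rat_box (q : 'rV[rat]_d * 'rV[rat]_d) : set 'rV[R]_d :=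
  [set x | forall i, ratr (q.1 0 i) <= x 0 i < ratr (q.2 0 i)].

(** Balls of the sup norm are cubes, so rational bounds within [e] of each coordinate, on either
    side, give a box inside the ball. *)
Lemma open_rat_box (U : set 'rV[R]_d) : open U ->
  U = \bigcup_(q in [set q | rat_box q `<=` U]) rat_box q.
Proof.
move=> oU; apply/seteqP; split=> [x Ux|x [q qU qx]]; last exact: qU.
have /nbhs_ballP[e /= e0 xeU] : nbhs x U by exact: open_nbhs_nbhs.
have ex_l (i : 'I_d) : exists q : rat, x 0 i - e < ratr q <= x 0 i.
  have xe : x 0 i - e < x 0 i by rewrite ltrBlDr ltrDl.
  by have [q] := rat_in_itvoo xe; rewrite in_itv/= => /andP[q1 /ltW q2]; exists q; rewrite q1.
have ex_r (i : 'I_d) : exists q : rat, x 0 i < ratr q < x 0 i + e.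
  have xe : x 0 i < x 0 i + e by rewrite ltrDl.
  by have [q] := rat_in_itvoo xe; rewrite in_itv/= => ?; exists q.
have [l xl] := choice ex_l; have [r xr] := choice ex_r.
exists (\row_i l i, \row_i r i) => /=.
  move=> y qy; apply: xeU; split => // i j; rewrite !ord1.
  have := qy j; rewrite /= !mxE => /andP[ly yr].
  have /andP[xl1 xl2] := xl j; have /andP[xr1 xr2] := xr j.
  rewrite -ball_normE /= distrC ltr_distl.
  by rewrite (lt_le_trans xl1 ly) (lt_trans yr xr2).
move=> i; rewrite /= !mxE.
by have /andP[_ ->] := xl i; have /andP[-> _] := xr i.
Qed.

Lemma caratheodory_open (mu : {outer_measure set 'rV[R]_d -> \bar R}) :
  (forall (i : 'I_d) (a : R), mu.-caratheodory [set x : 'rV[R]_d | x 0 i < a]) ->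
  forall U : set 'rV[R]_d, open U ->
    measurable (U : set (caratheodory_type mu)).
Proof.
move=> mhs U /open_rat_box ->.
have mH i a : measurable ([set x : 'rV[R]_d | x 0 i < a] : set (caratheodory_type mu)).
  exact: mhs.
rewrite bigcup_mkcond; apply: countable_bigcupT_measurable.
  exact: countableP.
move=> q; case: ifP => // _; rewrite -[rat_box q]setCK; apply: measurableC.
have -> : ~` rat_box q = \bigcup_i (~` [set x : 'rV[R]_d | x 0 i < ratr (q.2 0 i)] `|`
    [set x : 'rV[R]_d | x 0 i < ratr (q.1 0 i)]).
  apply/seteqP; split=> x.
    move=> /existsNP[i /negP]; rewrite negb_and -ltNge => /orP[xi|/negP xi].
      by exists i => //; right.
    by exists i => //; left.
  move=> [i _ [/= xi|/= xi]] /(_ i) /andP[xi1 xi2]; first exact: xi.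
  by move: xi; rewrite ltNge xi1.
apply: countable_bigcupT_measurable; first exact: countableP.
by move=> i; apply: measurableU => //; exact: measurableC.
Qed.

Lemma leb_measurable_open (U : set 'rV[R]_d) : open U ->
  measurable (U : set (lebT R d)).
Proof. by move=> oU; apply: caratheodory_open => // i a; exact: leb_outer_halfspace. Qed.

Lemma surf_measurable_open (U : set 'rV[R]_d) : open U ->
  measurable (U : set (surfT R d)).
Proof. by move=> oU; apply: caratheodory_open => // i a; exact: hausdorff_outer_halfspace. Qed.

Lemma leb_measurable_continuous (D : set (lebT R d)) (f : 'rV[R]_d -> R) :
  continuous f -> measurable_fun D (f : lebT R d -> R).
Proof.
move=> cf; apply: (measurable_funS measurableT) => //.
apply: (measurability _ (measurable_realfun.RGenOInfty.measurableE R)).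
move=> _ [_ [a ->] <-]; rewrite setTI.
apply: leb_measurable_open; apply: open_comp => [x _|]; first exact: cf.
exact: interval_open.
Qed.

Lemma surf_measurable_bdry (D : set 'rV[R]_d) : measurable (bdry D : set (surfT R d)).
Proof.
rewrite /bdry setDE; apply: measurableI.
  rewrite -[closure D]setCK; apply: measurableC; apply: surf_measurable_open.
  by apply: closed_openC; exact: closed_closure.
by apply: measurableC; apply: surf_measurable_open; exact: open_interior.
Qed.

End OpenMeasurable.

(** * Square integrable functions *)

Lemma measurable_fun_inv d (T : measurableType d) (R : realType) (D : set T)
  (f : T -> R) : measurable_fun D f -> measurable_fun D (fun x => (f x)^-1).
Proof.
(* This reduces inversion to a measurable real power of a nonnegative function; where [f] vanishes
   both sides are 0. *)
move=> mf; have -> : (fun x => (f x)^-1) = (fun x => f x * (f x ^+ 2) `^ (-1)).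
  apply/funext => x; rewrite powR_inv1 ?sqr_ge0//.
  have [->|fx0] := eqVneq (f x) 0; first by rewrite invr0 mul0r.
  by rewrite expr2 invfM mulVKf.
apply: measurable_funM => //.
apply: (measurableT_comp (measurable_powR (-1))).
exact: measurable_funX.
Qed.

Section SquareIntegrable.
Context {dsp : measure_display} {T : measurableType dsp} {R : realType}.
Variables (mu : {measure set T -> \bar R}) (D : set T).
Hypothesis mD : measurable D.
Implicit Types f g h : T -> R.

(** Stated for an arbitrary measure, so that [L2] (with [leb] on [D]) and [L2b] (with [surf] on
    [bdry D]) are both instances by conversion. *)
Definition sqintegrable f : Prop :=
  measurable_fun D f /\ (\int[mu]_(x in D) ((f x) ^+ 2)%:E < +oo)%E.

Lemma integrable_sq f : sqintegrable f ->
  mu.-integrable D (EFin \o (fun x => f x ^+ 2)).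
Proof.
move=> [mf f2]; apply/integrableP; split.
  by apply/measurable_EFinP; exact: measurable_funX.
apply: le_lt_trans f2; rewrite le_eqVlt; apply/orP; left; apply/eqP.
by apply: eq_integral => x _; rewrite /= ger0_norm ?sqr_ge0.
Qed.

Lemma integrableM f g : sqintegrable f -> sqintegrable g ->
  mu.-integrable D (EFin \o (fun x => f x * g x)).
Proof.
move=> sf sg.
have := integrableD mD (integrable_sq sf) (integrable_sq sg).
apply: le_integrable => //.
  by apply/measurable_EFinP; apply: measurable_funM; [exact: sf.1|exact: sg.1].
move=> x Dx; rewrite /= lee_fin [leRHS]ger0_norm ?addr_ge0 ?sqr_ge0//.
rewrite ler_norml; apply/andP; split; nra.
Qed.

Lemma ae_imply (P Q : T -> Prop) :
  {ae mu, forall x, P x} -> (forall x, P x -> Q x) -> {ae mu, forall x, Q x}.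
Proof. by move=> aeP PQ; apply: filterS aeP. Qed.

(** The bounds on [n] and [eta] hold only almost everywhere; deleting the exceptional null set [N]
    does not affect integrability, and outside it the domination is pointwise. *)
Lemma ae_le_integrable f g : measurable_fun D f ->
  mu.-integrable D (EFin \o g) -> {ae mu, forall x, D x -> `|f x| <= g x} ->
  mu.-integrable D (EFin \o f).
Proof.
move=> mf intg [N [mN N0 subN]].
have mf' : measurable_fun D (EFin \o f) by apply/measurable_EFinP.
apply/(negligible_integrable mN mD mf' N0).
have mDN : measurable (D `\` N) by exact: measurableD.
have intgN : mu.-integrable (D `\` N) (EFin \o g).
  by apply: integrableS intg.
apply: le_integrable intgN => //.
  by apply: measurable_funS mf'.
move=> x [Dx Nx]; rewrite /= lee_fin.
have fg : `|f x| <= g x.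
  by apply: contrapT => fg; apply: Nx; apply: subN => /(_ Dx).
by rewrite (le_trans fg)// ler_norm.
Qed.

Lemma ae_le_Rintegral f g : mu.-integrable D (EFin \o f) ->
  mu.-integrable D (EFin \o g) -> {ae mu, forall x, D x -> f x <= g x} ->
  \int[mu]_(x in D) f x <= \int[mu]_(x in D) g x.
Proof.
move=> intf intg [N [mN N0 subN]].
have mDN : measurable (D `\` N) by exact: measurableD.
rewrite /Rintegral (negligible_integral mN mD intf N0).
rewrite (negligible_integral mN mD intg N0).
apply: le_Rintegral => //.
- by apply: integrableS intf.
- by apply: integrableS intg.
by move=> x [Dx Nx]; apply: contrapT => fg; apply: Nx; apply: subN => /(_ Dx).
Qed.

Lemma Rintegral_sum (I : Type) (s : seq I) (F : I -> T -> R) :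
  (forall i, mu.-integrable D (EFin \o F i)) ->
  \int[mu]_(x in D) (\sum_(i <- s) F i x) = \sum_(i <- s) \int[mu]_(x in D) F i x.
Proof.
move=> intF; elim: s => [|i s IH].
  by under eq_Rintegral do rewrite big_nil; rewrite big_nil /Rintegral integral0.
under eq_Rintegral do rewrite big_cons.
rewrite big_cons -IH RintegralD//.
have := integrable_sum mD s (P := xpredT) (fun i _ => intF i).
by apply: eq_integrable => // x _; rewrite /= sumEFin.
Qed.

Lemma sqintegrableD f g : sqintegrable f -> sqintegrable g ->
  sqintegrable (fun x => f x + g x).
Proof.
move=> sf sg; split; first by apply: measurable_funD; [exact: sf.1|exact: sg.1].
have intfg := integrableD mD (integrable_sq sf) (integrable_sq sg).
have := integrable_lty mD (integrableZl mD 2 intfg).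
apply: le_lt_trans; apply: ge0_le_integral => //.
- by move=> x _; rewrite lee_fin sqr_ge0.
- apply/measurable_EFinP; apply: measurable_funX.
  by apply: measurable_funD; [exact: sf.1|exact: sg.1].
- by apply: (measurable_int mu); exact: integrableZl.
by move=> x _; rewrite /= lee_fin; have := sqr_ge0 (f x - g x); nra.
Qed.

Lemma sqintegrableMl h (M : R) f : measurable_fun D h ->
  {ae mu, forall x, D x -> `|h x| <= M} -> sqintegrable f ->
  sqintegrable (fun x => h x * f x).
Proof.
move=> mh hM sf; have mhf : measurable_fun D (fun x => h x * f x).
  by apply: measurable_funM => //; exact: sf.1.
split => //; apply: (@integrable_lty _ _ _ _ _ mD (EFin \o (fun x => (h x * f x) ^+ 2))).
apply: (@ae_le_integrable _ (fun x => M ^+ 2 * f x ^+ 2)).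
- exact: measurable_funX.
- exact: (integrableZl mD (M ^+ 2) (integrable_sq sf)).
apply: (ae_imply hM) => x hx Dx; have {}hx := hx Dx.
rewrite ger0_norm ?sqr_ge0// exprMn ler_wpM2r ?sqr_ge0//.
by rewrite -(ger0_norm (sqr_ge0 (h x))) normrX lerXn2r ?nnegrE// (le_trans _ hx).
Qed.

Lemma sqintegrableZ (c : R) f : sqintegrable f -> sqintegrable (fun x => c * f x).
Proof.
apply: (@sqintegrableMl (cst c) `|c|); first exact: measurable_cst.
by apply: aeW => x _ /=.
Qed.

Lemma sqintegrable0 : sqintegrable (cst 0).
Proof.
split; first exact: measurable_cst.
by under eq_integral do rewrite expr0n/=; rewrite integral0.
Qed.

Lemma sqintegrable_sum (I : Type) (s : seq I) (F : I -> T -> R) :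
  (forall i, sqintegrable (F i)) -> sqintegrable (fun x => \sum_(i <- s) F i x).
Proof.
move=> sF; elim: s => [|i s IH].
  by under eq_fun do rewrite big_nil; exact: sqintegrable0.
by under eq_fun do rewrite big_cons; exact: sqintegrableD.
Qed.

Lemma sqintegrableN f : sqintegrable f -> sqintegrable (fun x => - f x).
Proof. by move=> /(sqintegrableZ (-1)); under eq_fun do rewrite mulN1r. Qed.

Lemma sqintegrableB f g : sqintegrable f -> sqintegrable g ->
  sqintegrable (fun x => f x - g x).
Proof. by move=> sf /sqintegrableN; exact: sqintegrableD. Qed.

(** Young's inequality with weight [t], playing the part of Cauchy-Schwarz: when the integral of
    [g ^+ 2] is at most [t ^+ 2], the whole right-hand side is of order [t]. *)
Lemma normr_Rintegral_mul_le f g (t : R) : 0 < t ->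
  sqintegrable f -> sqintegrable g ->
  `|\int[mu]_(x in D) (f x * g x)| <=
    t * \int[mu]_(x in D) (f x ^+ 2) + t^-1 * \int[mu]_(x in D) (g x ^+ 2).
Proof.
move=> t0 sf sg; apply: le_trans (le_normr_Rintegral mD (integrableM sf sg)) _.
have intf := integrable_sq sf; have intg := integrable_sq sg.
have iF : mu.-integrable D (EFin \o (fun x => t * f x ^+ 2)) := integrableZl mD t intf.
have iG : mu.-integrable D (EFin \o (fun x => t^-1 * g x ^+ 2)) := integrableZl mD t^-1 intg.
rewrite -!RintegralZl// -RintegralD//.
apply: le_Rintegral => //; first exact: (integrable_norm (integrableM sf sg)).
  exact: (integrableD mD iF iG).
move=> x Dx; rewrite normrM.
have -> : t * f x ^+ 2 + t^-1 * g x ^+ 2 = t^-1 * ((t * `|f x|) ^+ 2 + `|g x| ^+ 2).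
  rewrite exprMn !real_normK ?num_real// mulrDr; congr (_ + _).
  by rewrite expr2 -mulrA mulKf ?gt_eqF.
rewrite -ler_pdivrMl ?invr_gt0// invrK.
have := sqr_ge0 (t * `|f x| - `|g x|); have := normr_ge0 (f x); have := normr_ge0 (g x).
by have := mulr_ge0 (ltW t0) (mulr_ge0 (normr_ge0 (f x)) (normr_ge0 (g x))); nra.
Qed.

End SquareIntegrable.

(** * Green's formula *)

Section Green.
Context {R : realType} {d : nat}.
Variable D : set 'rV[R]_d.
Hypothesis oD : open D.
Implicit Types f g : 'rV[R]_d -> R.

Let mD : measurable (D : set (lebT R d)). Proof. exact: leb_measurable_open. Qed.

Local Notation sqint := (@sqintegrable _ (lebT R d) R (leb R d) D).

Lemma wpartialP i f : (exists g, is_wpartial D i f g) ->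
  is_wpartial D i f (wpartial D i f).
Proof. exact: (@xgetPex _ (fun=> 0) [set g | is_wpartial D i f g]). Qed.

(** Each of the two squared distances is one nonnegative summand of [sqdist_H1], hence below [e];
    finiteness then allows the passage to real integrals. *)
Lemma test_function_near f (e : R) i : 0 < e -> H10 D f ->
  exists phi, [/\ test_function D phi, sqint (fun x => f x - phi x),
    sqint (fun x => wpartial D i f x - partial i phi x),
    \int[leb R d]_(x in D) ((f x - phi x) ^+ 2) <= e &
    \int[leb R d]_(x in D) ((wpartial D i f x - partial i phi x) ^+ 2) <= e].
Proof.
move=> e0 [[L2f wf] /(_ _ e0)[phi [tphi dist_phi]]]; exists phi.
have cphi : continuous phi by case: tphi => /(_ 0%N).
have cdphi : continuous (partial i phi) by case: tphi => /(_ 1%N)/(_ i)[].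
have sq_ge0 (u v : 'rV[R]_d -> R) : (0 <= sqdist_L2 D u v)%E.
  by apply: integral_ge0 => x _; rewrite lee_fin sqr_ge0.
have sum_ge0 (P : pred 'I_d) :
    (0 <= \sum_(j < d | P j) sqdist_L2 D (wpartial D j f) (partial j phi))%E.
  by apply: sume_ge0 => j _.
have dist0 : (sqdist_L2 D f phi < e%:E)%E.
  by apply: le_lt_trans dist_phi; rewrite leeDl.
have dist1 : (sqdist_L2 D (wpartial D i f) (partial i phi) < e%:E)%E.
  apply: le_lt_trans dist_phi; rewrite /sqdist_H1 (bigD1 i)//= addeCA leeDl//.
  by rewrite adde_ge0.
have fine_le u : (0 <= u < e%:E)%E -> fine u <= e.
  by case: u => [r||] /andP[_]//; rewrite lte_fin => /ltW.
split; [exact: tphi| | | |].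
- split; last by apply: lt_trans dist0 _; rewrite ltry.
  by apply: measurable_funB; [exact: L2f.1|exact: leb_measurable_continuous].
- split; last by apply: lt_trans dist1 _; rewrite ltry.
  apply: measurable_funB; last exact: leb_measurable_continuous.
  by have [[]] := wpartialP (wf i).
- by apply: fine_le; rewrite sq_ge0 dist0.
- by apply: fine_le; rewrite sq_ge0 dist1.
Qed.

(** The weak derivative [h] of [g] can be tested only against test functions. Replacing [f] by a
    nearby [phi] leaves the error terms [h * (f - phi)] and [g * (g - partial i phi)], both small in
    the integral. *)
Lemma Green_partial i f : H2 D f -> H10 D f ->
  \int[leb R d]_(x in D) (f x * wpartial D i (wpartial D i f) x) =
  - \int[leb R d]_(x in D) (wpartial D i f x ^+ 2).
Proof.
move=> [H1f wwf] H10f.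
set g := wpartial D i f; set h := wpartial D i g.
have sf : sqint f := H1f.1.
have sg : sqint g := (wpartialP (H1f.2 i)).1.
have [sh int_parts] : sqint h /\ _ := wpartialP (wwf i i).
apply/eqP; rewrite -subr_eq0 opprK -normr_le0.
pose C := \int[leb R d]_(x in D) (g x ^+ 2) + \int[leb R d]_(x in D) (h x ^+ 2).
have C0 : 0 <= C by apply: addr_ge0; apply: Rintegral_ge0 => x _; exact: sqr_ge0.
(* With [phi] at squared distance at most [t ^+ 2], Young's inequality bounds the two errors by [t]
   times the integrals making up [C], plus [t] each, whence [C + 2]. *)
suff bound t : 0 < t -> `|\int[leb R d]_(x in D) (f x * h x) +
    \int[leb R d]_(x in D) (g x ^+ 2)| <= t * (C + 2).
  apply/ler_addgt0Pr => e e0; rewrite add0r.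
  have C2 : 0 < C + 2 by rewrite ltr_wpDl.
  apply: le_trans (bound (e / (C + 2)) _) _; first by rewrite divr_gt0.
  by rewrite divfK ?gt_eqF.
move=> t0; have t20 : 0 < t ^+ 2 by rewrite exprn_gt0.
have [phi [tphi s0 s1 d0 d1]] := test_function_near i t20 H10f.
have sphi : sqint phi.
  have := sqintegrableB mD sf s0.
  by under eq_fun do rewrite subKr.
have sdphi : sqint (partial i phi).
  have := sqintegrableB mD sg s1.
  by under eq_fun do rewrite subKr.
have -> : \int[leb R d]_(x in D) (f x * h x) + \int[leb R d]_(x in D) (g x ^+ 2) =
    \int[leb R d]_(x in D) (h x * (f x - phi x)) +
    \int[leb R d]_(x in D) (g x * (g x - partial i phi x)).
  under [X in _ = X + _]eq_Rintegral do rewrite mulrBr.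
  under [X in _ = _ + X]eq_Rintegral do rewrite mulrBr.
  have ihf := integrableM mD sh sf; have ihp := integrableM mD sh sphi.
  have igg := integrableM mD sg sg; have igp := integrableM mD sg sdphi.
  rewrite (RintegralB mD ihf ihp) (RintegralB mD igg igp) (int_parts _ tphi).
  rewrite opprK addrACA addNr addr0.
  by congr (_ + _); apply: eq_Rintegral => x _; exact: mulrC.
apply: le_trans (ler_normD _ _) _.
have le0 := normr_Rintegral_mul_le mD t0 sh s0.
have le1 := normr_Rintegral_mul_le mD t0 sg s1.
have le_t a : a <= t ^+ 2 -> t^-1 * a <= t.
  by rewrite expr2 ler_pdivrMl.
have collect (p q r s : R) : r <= t -> s <= t ->
    (t * p + r) + (t * q + s) <= t * (q + p + 2).
  move=> rt st; have -> : t * (q + p + 2) = (t * p + t) + (t * q + t) by ring.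
  by do 2?apply: lerD.
apply: le_trans (lerD le0 le1) _; rewrite /C.
exact: (collect _ _ _ _ (le_t _ d0) (le_t _ d1)).
Qed.

Lemma Green_laplacian f : H2 D f -> H10 D f ->
  \int[leb R d]_(x in D) (f x * wlaplacian D f x) =
  - \sum_(i < d) \int[leb R d]_(x in D) (wpartial D i f x ^+ 2).
Proof.
move=> H2f H10f.
rewrite -sumrN; under [RHS]eq_bigr do rewrite -(Green_partial _ H2f H10f).
rewrite /wlaplacian; under eq_Rintegral do rewrite mulr_sumr.
rewrite Rintegral_sum// => i; apply: (integrableM mD); first exact: H2f.1.1.
exact: (wpartialP (H2f.2 i i)).1.
Qed.

Lemma sqintegrable_wlaplacian f : H2 D f -> sqint (wlaplacian D f).
Proof.
move=> H2f; apply: (sqintegrable_sum mD) => i.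
exact: (wpartialP (H2f.2 i i)).1.
Qed.

End Green.

(** * The eigenvalue bounds *)

Section ScalarBounds.
Context {R : realFieldType}.
Implicit Types n N a b : R.

Let index_gt1_bound1 n N a b : 1 < n -> n <= N ->
  a ^+ 2 / N + a * b <= (n - 1)^-1 * ((a + n * b) * (a + b)).
Proof.
move=> n1 nN; have n0 : 0 < n by lra.
(* Completing the square in [a + n * b] leaves a remainder that is nonnegative for [n > 1]. *)
have -> : (n - 1)^-1 * ((a + n * b) * (a + b)) =
    a ^+ 2 / n + a * b + (a + n * b) ^+ 2 / (n * (n - 1)).
  by field; apply/andP; split; lra.
rewrite -[leLHS]addr0; apply: lerD; last first.
  by rewrite divr_ge0 ?sqr_ge0// mulr_ge0; lra.
by rewrite lerD2r ler_wpM2l ?sqr_ge0// lef_pV2 ?posrE//; lra.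
Qed.

Let index_lt1_bound1 n a b : 0 <= n -> n < 1 ->
  (n - 1)^-1 * ((a + n * b) * (a + b)) <= - (a ^+ 2 + a * b).
Proof.
move=> n0 n1.
(* Here the square is completed in [a + b], and the sign of the remainder is controlled by
   [0 <= n < 1]. *)
have -> : (n - 1)^-1 * ((a + n * b) * (a + b)) =
    - (a ^+ 2 + a * b) - n * (a + b) ^+ 2 / (1 - n).
  by field; apply/andP; split; lra.
by rewrite gerBl divr_ge0 ?subr_ge0 ?(ltW n1)// mulr_ge0 ?sqr_ge0.
Qed.

(** To be read with [a], [b] the real and imaginary parts of the Laplacian of [u], [p], [q] those of
    [u], and [t] equal to [k ^+ 2]. *)
Lemma index_gt1_bound n N t a b p q : 1 < n -> n <= N ->
  N^-1 * (a ^+ 2 + b ^+ 2) + t * (a * p + b * q) <=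
  (n - 1)^-1 * ((a + n * (t * p)) * (a + t * p)) +
  (n - 1)^-1 * ((b + n * (t * q)) * (b + t * q)).
Proof.
move=> n1 nN.
apply: le_trans (lerD (index_gt1_bound1 a (t * p) n1 nN) (index_gt1_bound1 b (t * q) n1 nN)).
rewrite le_eqVlt; apply/orP; left; apply/eqP; ring.
Qed.

Lemma index_lt1_bound n t a b p q : 0 <= n -> n < 1 ->
  (n - 1)^-1 * ((a + n * (t * p)) * (a + t * p)) +
  (n - 1)^-1 * ((b + n * (t * q)) * (b + t * q)) <=
  -1 * (a ^+ 2 + b ^+ 2) + - t * (a * p + b * q).
Proof.
move=> n0 n1.
apply: le_trans (lerD (index_lt1_bound1 a (t * p) n0 n1) (index_lt1_bound1 b (t * q) n0 n1)) _.
rewrite le_eqVlt; apply/orP; left; apply/eqP; ring.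
Qed.

End ScalarBounds.

(** * The real part of the variational equation *)

Section ComplexToReal.
Context {R : realType} {d : nat}.
Local Open Scope complex_scope.

(** Since [k] is real, all coefficients are real, so the real part decouples into one copy for real
    parts and one for imaginary parts. *)
Lemma Re_interior_integrand (n k : R) (L U : R[i]) :
  complex.Re (((n - 1)^-1)%:C * (L + k%:C ^+ 2 * n%:C * U) * (L^* + k%:C ^+ 2 * U^*)) =
  (n - 1)^-1 * ((complex.Re L + n * (k ^+ 2 * complex.Re U)) *
                (complex.Re L + k ^+ 2 * complex.Re U)) +
  (n - 1)^-1 * ((complex.Im L + n * (k ^+ 2 * complex.Im U)) *
                (complex.Im L + k ^+ 2 * complex.Im U)).
Proof. by case: L U => a b [p q]; rewrite -rmorphXn /=; ring. Qed.

Lemma Re_boundary_integrand (eta k : R) (V : R[i]) :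
  complex.Re (k%:C ^+ 2 / eta%:C * V * V^*) =
  k ^+ 2 * (eta^-1 * complex.Re V * complex.Re V) +
  k ^+ 2 * (eta^-1 * complex.Im V * complex.Im V).
Proof. by case: V => a b; rewrite -rmorphXn -fmorphV /=; ring. Qed.

Lemma variational_Re (D : set 'rV[R]_d) (n eta : 'rV[R]_d -> R) (k : R)
    (u : 'rV[R]_d -> R[i]) :
  int_dom D (fun x => ((n x - 1)^-1)%:C *
                          (lap D u x + k%:C ^+ 2 * (n x)%:C * u x) *
                          ((lap D u x)^* + k%:C ^+ 2 * (u x)^*)) +
      int_bdry D (fun x => k%:C ^+ 2 / (eta x)%:C * dnu D u x * (dnu D u x)^*)
      = 0 ->
  \int[leb R d]_(x in D)
    ((n x - 1)^-1 * ((wlaplacian D (re u) x + n x * (k ^+ 2 * re u x)) *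
                     (wlaplacian D (re u) x + k ^+ 2 * re u x)) +
     (n x - 1)^-1 * ((wlaplacian D (im u) x + n x * (k ^+ 2 * im u x)) *
                     (wlaplacian D (im u) x + k ^+ 2 * im u x))) +
  \int[surf R d]_(x in bdry D)
    (k ^+ 2 * ((eta x)^-1 * normal_derivative D (re u) x *
                normal_derivative D (re u) x) +
     k ^+ 2 * ((eta x)^-1 * normal_derivative D (im u) x *
                normal_derivative D (im u) x))
  = 0.
Proof.
move=> /(congr1 (@complex.Re R)) /= eqRe; rewrite -[RHS]eqRe; congr (_ + _).
  by apply: eq_Rintegral => x _; rewrite /re Re_interior_integrand.
by apply: eq_Rintegral => x _; rewrite /re Re_boundary_integrand.
Qed.

End ComplexToReal.

(** * Integral estimates for an eigenfunction *)

Section Eigenvalue.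
Context {R : realType} {d : nat}.
Variable D : set 'rV[R]_d.
Hypothesis oD : open D.
Implicit Types u : 'rV[R]_d -> R[i].

Let mD : measurable (D : set (lebT R d)). Proof. exact: leb_measurable_open. Qed.
Let mB : measurable (bdry D : set (surfT R d)). Proof. exact: surf_measurable_bdry. Qed.

Local Notation sqint := (@sqintegrable _ (lebT R d) R (leb R d) D).
Local Notation sqintb := (@sqintegrable _ (surfT R d) R (surf R d) (bdry D)).

Definition sqnorm_grad u : R := \sum_(i < d) sqnorm_dom D (pd D i u).

Lemma Rintegral_sqmod u : sqint (re u) -> sqint (im u) ->
  sqnorm_dom D u = \int[leb R d]_(x in D) (re u x ^+ 2) + \int[leb R d]_(x in D) (im u x ^+ 2).
Proof.
by move=> sr si; rewrite -(RintegralD mD (integrable_sq sr) (integrable_sq si)).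
Qed.

Lemma Green_complex u : X D u ->
  \int[leb R d]_(x in D) (wlaplacian D (re u) x * re u x + wlaplacian D (im u) x * im u x) =
  - sqnorm_grad u.
Proof.
move=> [[H2r H10r] [H2i H10i]].
have sr := H2r.1.1; have si := H2i.1.1.
have sLr := sqintegrable_wlaplacian oD H2r; have sLi := sqintegrable_wlaplacian oD H2i.
rewrite (RintegralD mD (integrableM mD sLr sr) (integrableM mD sLi si)).
under eq_Rintegral do rewrite mulrC.
rewrite (Green_laplacian oD H2r H10r).
under eq_Rintegral do rewrite mulrC.
rewrite (Green_laplacian oD H2i H10i).
rewrite -opprD -big_split/=; congr (- _); apply: eq_bigr => i _.
have sdr := (wpartialP (H2r.1.2 i)).1; have sdi := (wpartialP (H2i.1.2 i)).1.
by rewrite (Rintegral_sqmod (u := pd D i u) sdr sdi).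
Qed.

(** No regularity of [f] enters: [xget] returns either a normal derivative, square integrable by
    definition, or the zero function. *)
Lemma normal_derivative_sqintegrable (f : 'rV[R]_d -> R) : sqintb (normal_derivative D f).
Proof.
rewrite /normal_derivative; case: xgetP => [g -> [L2g _]|_]; first exact: L2g.
exact: sqintegrable0.
Qed.

Lemma first_buckling_eigenvalue_bound (lambda1 : R) u :
  first_buckling_eigenvalue D lambda1 -> X D u -> nontrivial D u ->
  [/\ 0 < lambda1, 0 < sqnorm_grad u & lambda1 * sqnorm_grad u <= sqnorm_dom D (lap D u)].
Proof.
move=> [[l0 _] _ _ lb] Xu u0.
have lu : lambda1 <= sqnorm_dom D (lap D u) / sqnorm_grad u by apply: lb; exists u.
have g0 : 0 <= sqnorm_grad u.
  apply: sumr_ge0 => i _; apply: Rintegral_ge0 => x _.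
  by rewrite addr_ge0// sqr_ge0.
(* Division by 0 yields 0, so a vanishing gradient would make the Rayleigh quotient 0, below the
   positive [lambda1]. *)
have g1 : 0 < sqnorm_grad u.
  rewrite lt_def g0 andbT; apply/eqP => g; move: lu.
  by rewrite g invr0 mulr0 leNgt l0.
by split => //; rewrite -ler_pdivlMr.
Qed.

Section IndexBounds.
Variables (n : 'rV[R]_d -> R) (k : R) (u : 'rV[R]_d -> R[i]).
Hypotheses (hn : refractive_index D n) (Xu : X D u).

(* The real part of the interior integrand of the variational equation tested
   with [u] itself. *)
Local Notation interior_integrand := (fun x =>
    ((n x - 1)^-1 * ((wlaplacian D (re u) x + n x * (k ^+ 2 * re u x)) *
                     (wlaplacian D (re u) x + k ^+ 2 * re u x)) +
     (n x - 1)^-1 * ((wlaplacian D (im u) x + n x * (k ^+ 2 * im u x)) *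
                     (wlaplacian D (im u) x + k ^+ 2 * im u x)))).

(** [n] is bounded and [(n - 1)^-1] is bounded by [c^-1] almost everywhere, so each summand is a
    product of two square integrable functions. *)
Lemma integrable_interior_integrand :
  (leb R d).-integrable D (EFin \o interior_integrand).
Proof.
have [mn [M nM] [c [c0 nc]]] := hn.
have naeM : {ae leb R d, forall x, D x -> `|n x| <= M} by exact: aeW.
have mh : measurable_fun (D : set (lebT R d)) (fun x : lebT R d => (n x - 1)^-1).
  by apply: measurable_fun_inv; apply: measurable_funB => //; exact: measurable_cst.
have hc : {ae leb R d, forall x, D x -> `|(n x - 1)^-1| <= c^-1}.
  apply: (ae_imply nc) => x nx Dx; rewrite normfV lef_pV2 ?posrE ?nx//.
  exact: lt_le_trans c0 (nx Dx).
have sub v : sqint v -> sqint (wlaplacian D v) ->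
    (leb R d).-integrable D (EFin \o (fun x => (n x - 1)^-1 *
      ((wlaplacian D v x + n x * (k ^+ 2 * v x)) * (wlaplacian D v x + k ^+ 2 * v x)))).
  move=> sv sL; have skv : sqint (fun x => k ^+ 2 * v x) := sqintegrableZ mD (k ^+ 2) sv.
  have s1 := sqintegrableD mD sL (sqintegrableMl mD mn naeM skv).
  have := integrableM mD (sqintegrableMl mD mh hc s1) (sqintegrableD mD sL skv).
  by under eq_fun do rewrite -mulrA.
have [[H2r _] [H2i _]] := Xu.
have := integrableD mD (sub _ H2r.1.1 (sqintegrable_wlaplacian oD H2r))
  (sub _ H2i.1.1 (sqintegrable_wlaplacian oD H2i)).
by [].
Qed.

(** The free coefficients cover both cases: [nmax^-1] and [k ^+ 2] for index above 1, [- 1] and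
    [- k ^+ 2] for index below 1. Green's formula turns the mixed term into the gradient norm. *)
Lemma integrable_comparison (s t : R) :
  (leb R d).-integrable D (EFin \o (fun x => s * sqmod (lap D u x) +
    t * (wlaplacian D (re u) x * re u x + wlaplacian D (im u) x * im u x))) /\
  \int[leb R d]_(x in D) (s * sqmod (lap D u x) +
    t * (wlaplacian D (re u) x * re u x + wlaplacian D (im u) x * im u x)) =
  s * sqnorm_dom D (lap D u) - t * sqnorm_grad u.
Proof.
have [[H2r _] [H2i _]] := Xu.
have sr := H2r.1.1; have si := H2i.1.1.
have sLr := sqintegrable_wlaplacian oD H2r; have sLi := sqintegrable_wlaplacian oD H2i.
have i1 : (leb R d).-integrable D (EFin \o (fun x => sqmod (lap D u x))).
  exact: (integrableD mD (integrable_sq sLr) (integrable_sq sLi)).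
have i2 : (leb R d).-integrable D (EFin \o (fun x =>
    wlaplacian D (re u) x * re u x + wlaplacian D (im u) x * im u x)).
  exact: (integrableD mD (integrableM mD sLr sr) (integrableM mD sLi si)).
have i1' : (leb R d).-integrable D (EFin \o (fun x => s * sqmod (lap D u x))).
  exact: (integrableZl mD s i1).
have i2' : (leb R d).-integrable D (EFin \o (fun x => t *
    (wlaplacian D (re u) x * re u x + wlaplacian D (im u) x * im u x))).
  exact: (integrableZl mD t i2).
split; first exact: (integrableD mD i1' i2').
by rewrite RintegralD// !RintegralZl// Green_complex// mulrN.
Qed.

Lemma interior_integral_gt1 (nmin nmax : R) : 1 < nmin ->
  {ae leb R d, forall x, D x -> nmin <= n x <= nmax} ->
  nmax^-1 * sqnorm_dom D (lap D u) - k ^+ 2 * sqnorm_grad u <=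
  \int[leb R d]_(x in D) interior_integrand x.
Proof.
move=> n1 nb; have [intc <-] := integrable_comparison nmax^-1 (k ^+ 2).
apply: (ae_le_Rintegral mD intc integrable_interior_integrand).
apply: (ae_imply nb) => x nx /nx /andP[nminx nmaxx].
have n1x := lt_le_trans n1 nminx.
exact: (index_gt1_bound _ _ _ _ _ n1x nmaxx).
Qed.

Lemma interior_integral_lt1 (nmin nmax : R) : 0 <= nmin -> nmax < 1 ->
  {ae leb R d, forall x, D x -> nmin <= n x <= nmax} ->
  \int[leb R d]_(x in D) interior_integrand x <=
  k ^+ 2 * sqnorm_grad u - sqnorm_dom D (lap D u).
Proof.
move=> n0 n1 nb; have [intc] := integrable_comparison (- 1) (- k ^+ 2).
rewrite mulN1r mulNr opprK addrC => <-.
apply: (ae_le_Rintegral mD integrable_interior_integrand intc).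
apply: (ae_imply nb) => x nx /nx /andP[nminx nmaxx].
have n0x := le_trans n0 nminx; have n1x := le_lt_trans nmaxx n1.
exact: (index_lt1_bound _ _ _ _ _ n0x n1x).
Qed.

End IndexBounds.

(** Almost everywhere [(eta x)^-1] lies between 0 and [etamin^-1]. The lower bound serves the case
    of index above 1, the upper bound the other. *)
Lemma boundary_integral_bounds (eta : 'rV[R]_d -> R) (etamin etamax k : R) u :
  conductivity D eta etamin etamax ->
  0 <= \int[surf R d]_(x in bdry D)
    (k ^+ 2 * ((eta x)^-1 * normal_derivative D (re u) x *
                normal_derivative D (re u) x) +
     k ^+ 2 * ((eta x)^-1 * normal_derivative D (im u) x *
                normal_derivative D (im u) x))
  <= k ^+ 2 / etamin * sqnorm_bdry D (dnu D u).
Proof.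
move=> [meta _ em0 etab].
set a := normal_derivative D (re u); set b := normal_derivative D (im u).
have sa : sqintb a by exact: normal_derivative_sqintegrable.
have sb : sqintb b by exact: normal_derivative_sqintegrable.
have minv : measurable_fun (bdry D : set (surfT R d)) (fun x : surfT R d => (eta x)^-1).
  exact: measurable_fun_inv.
have invb : {ae surf R d, forall x, bdry D x -> `|(eta x)^-1| <= etamin^-1}.
  apply: (ae_imply etab) => x ex /ex /andP[e1 _].
  have e0 := lt_le_trans em0 e1.
  by rewrite normfV gtr0_norm// lef_pV2 ?posrE.
have sub v : sqintb v -> (surf R d).-integrable (bdry D)
    (EFin \o (fun x => k ^+ 2 * ((eta x)^-1 * v x * v x))).
  move=> sv; exact: (integrableZl mB (k ^+ 2)
    (integrableM mB (sqintegrableMl mB minv invb sv) sv)).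
have intF := integrableD mB (sub _ sa) (sub _ sb).
have ints : (surf R d).-integrable (bdry D) (EFin \o (fun x => sqmod (dnu D u x))).
  exact: (integrableD mB (integrable_sq sa) (integrable_sq sb)).
have bound x v : etamin <= eta x ->
    0 <= k ^+ 2 * ((eta x)^-1 * v * v) <= k ^+ 2 / etamin * v ^+ 2.
  move=> e1; have e0 := lt_le_trans em0 e1.
  have -> : k ^+ 2 * ((eta x)^-1 * v * v) = k ^+ 2 * v ^+ 2 * (eta x)^-1 by ring.
  have -> : k ^+ 2 / etamin * v ^+ 2 = k ^+ 2 * v ^+ 2 / etamin by ring.
  have kv0 : 0 <= k ^+ 2 * v ^+ 2 by rewrite -exprMn sqr_ge0.
  by rewrite divr_ge0 ?(ltW e0)//= ler_wpM2l// lef_pV2 ?posrE.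
apply/andP; split.
  rewrite -[leLHS](_ : \int[surf R d]_(x in bdry D) 0 = 0); last by rewrite /Rintegral integral0.
  apply: (ae_le_Rintegral mB) => //; first exact: integrable0.
  apply: (ae_imply etab) => x ex /ex /andP[e1 _].
  by rewrite addr_ge0//; [have /andP[] := bound x (a x) e1|have /andP[] := bound x (b x) e1].
rewrite -RintegralZl//; apply: (ae_le_Rintegral mB) => //.
  exact: (integrableZl mB (k ^+ 2 / etamin) ints).
apply: (ae_imply etab) => x ex /ex /andP[e1 _].
rewrite /sqmod /= mulrDr; apply: lerD.
  by have /andP[] := bound x (a x) e1.
by have /andP[] := bound x (b x) e1.
Qed.

End Eigenvalue.

(** * Assembling the two lower bounds *)

Local Open Scope complex_scope.

Theorem theorem2p1 (R : realType) (d : nat) (D : set 'rV[R]_d)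
    (n eta : 'rV[R]_d -> R) (etamin etamax nmin nmax lambda1 CT k : R)
    (hd : d = 2%N \/ d = 3%N)
    (hopen : open D) (hbounded : bounded_set D)
    (hconn : simply_connected R D)
    (hbdry : C2_boundary D \/ polygonal_nonreentrant D)
    (hn : refractive_index D n) (heta : conductivity D eta etamin etamax)
    (hnbounds : {ae leb R d, forall x, D x -> nmin <= n x <= nmax})
    (hk : transmission_eigenvalue D n eta k%:C)
    (hlambda1 : first_buckling_eigenvalue D lambda1)
    (hCT : trace_constant D CT) :
  (1 < nmin -> lambda1 / nmax <= k ^+ 2) /\
  (0 <= nmin -> nmax < 1 ->
     lambda1 * etamin / (etamin + CT * lambda1) <= k ^+ 2).
Proof.
have [u [Xu u0 /(_ u Xu)/variational_Re int0]] := hk.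
have [l0 g0 lg] := first_buckling_eigenvalue_bound hlambda1 Xu u0.
have /andP[bd0 bd1] := boundary_integral_bounds k u heta.
have em0 : 0 < etamin by case: heta.
have k2 : 0 <= k ^+ 2 by exact: sqr_ge0.
set S := sqnorm_dom D (lap D u) in lg; set G := sqnorm_grad D u in g0 lg.
split=> [n1|n0 n1].
  have := interior_integral_gt1 hopen k hn Xu n1 hnbounds; rewrite -/S -/G => le_int.
  (* For nonpositive [nmax] the bound is immediate, its left-hand side being nonpositive; this
     avoids deriving [1 < nmax] from [D] having positive measure. *)
  have [N0|N0] := leP nmax 0.
    by apply: le_trans k2; rewrite pmulr_rle0// invr_le0.
  have SG : nmax^-1 * S <= k ^+ 2 * G by lra.
  rewrite -(ler_pM2r g0); apply: le_trans SG.
  by rewrite mulrAC mulrC ler_wpM2l// invr_ge0 ltW.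
have := interior_integral_lt1 hopen k hn Xu n0 n1 hnbounds; rewrite -/S -/G => le_int.
have S0 : 0 < S by apply: lt_le_trans lg; rewrite mulr_gt0.
have tr := hCT u Xu; rewrite -/S in tr.
(* The trace inequality for [u] itself, with [S] positive, forces the sign of [CT], and with it that
   of the denominator. *)
have CT0 : 0 <= CT.
  rewrite -(pmulr_lge0 _ S0); apply: le_trans tr.
  by apply: Rintegral_ge0 => x _; rewrite addr_ge0// sqr_ge0.
have den0 : 0 < etamin + CT * lambda1 by rewrite ltr_pwDl// mulr_ge0// ltW.
rewrite ler_pdivrMr//.
have SG : S <= k ^+ 2 * G + k ^+ 2 / etamin * (CT * S).
  have := ler_wpM2l (divr_ge0 k2 (ltW em0)) tr; lra.
rewrite -(ler_pM2r S0).
(* Scaling [SG] by [lambda1 * etamin] clears the division by [etamin]; then [lambda1 * G <= S]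
   removes [G], and every term carries the factor [S] that was introduced to be cancelled. *)
have le1 : lambda1 * etamin * S <=
    lambda1 * etamin * (k ^+ 2 * G + k ^+ 2 / etamin * (CT * S)).
  by rewrite ler_wpM2l// mulr_ge0// ltW.
have E1 : lambda1 * etamin * (k ^+ 2 * G + k ^+ 2 / etamin * (CT * S)) =
    k ^+ 2 * etamin * (lambda1 * G) + k ^+ 2 * (CT * lambda1) * S.
  by field; rewrite gt_eqF.
have le2 : k ^+ 2 * etamin * (lambda1 * G) <= k ^+ 2 * etamin * S.
  by rewrite ler_wpM2l// mulr_ge0// ltW.
move: le1; rewrite E1; lra.
Qed.
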